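(* Let $X$ be a set, and let $F\{X\}$, $D_X$ and $i_X$ be as constructed in the context. (1) The pair $(F\{X\},D_X)$ is a differential group. (2) The triple $(F\{X\},D_X,i_X)$ is a free differential group on $X$; that is, for every differential group $(G,d)$ and every map of sets $f:X\to G$, there is a unique homomorphism of differential groups $\overline{f}:(F\{X\},D_X)\to(G,d)$ such that $\overline{f}\, i_X=f$.
   Context: A differential group (of weight $1$) is a pair $(G,d)$ consisting of a group $G$ and a map $d:G\to G$ satisfying $d(gh)=d(g)\,g\,d(h)\,g^{-1}$ for all $g,h\in G$. A homomorphism of differential groups $(G,d)\to(G',d')$ is a group homomorphism $\varphi:G\to G'$ with $d'\varphi=\varphi d$. Construction. For a set $X$ let $\Delta X:=X\times\mathbb{N}=\{x^{(n)}:=(x,n)\mid x\in X,\ n\in\mathbb{N}\}$ with $\mathbb{N}=\{0,1,2,\dots\}$, and let $F\{X\}:=F(\Delta X)$ be the free group on $\Delta X$, whose elements are reduced words in the letters $\Delta X\cup(\Delta X)^{-1}$. Define $D=D_X:F\{X\}\to F\{X\}$ by recursion on the length of reduced words: $D(1)=1$; for $x\in X$ and $n\ge0$, $D(x^{(n)}):=x^{(n+1)}$ and $D((x^{(n)})^{-1}):=(x^{(n)})^{-1}(x^{(n+1)})^{-1}x^{(n)}$; and for a reduced word $\mathfrak{x}=\mathfrak{x}_1\cdots\mathfrak{x}_{m+1}$ of length $m+1\ge2$ with $\mathfrak{x}_i\in\Delta X\cup(\Delta X)^{-1}$, $D(\mathfrak{x}):=D(\mathfrak{x}_1)\,\mathfrak{x}_1\,D(\mathfrak{x}_2\cdots\mathfrak{x}_{m+1})\,\mathfrak{x}_1^{-1}$.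 Let $i_X:X\to F\{X\}$ be the map $x\mapsto x^{(0)}$. *)

(* Defs.v *)
From HB Require Import structures.
From mathcomp Require Import all_boot.
From mathcomp Require Import boolp.

Set Implicit Arguments.
Unset Strict Implicit.
Unset Printing Implicit Defensive.

Import Algebra.
Local Open Scope group_scope.

Definition is_differential (G : groupType) (d : G -> G) : Prop :=
  forall g h : G, d (g * h) = d g * g * d h * g^-1.

Definition is_diff_hom (G H : groupType) (d : G -> G) (d' : H -> H)
    (phi : G -> H) : Prop :=
  monoid_morphism phi /\ d' \o phi =1 phi \o d.

Definition is_free_diff_group (X : Type) (F : groupType) (D : F -> F)
    (i : X -> F) : Prop :=
  is_differential D /\
  forall (G : groupType) (d : G -> G), is_differential d ->
  forall f : X -> G,
  exists! fbar : F -> G, is_diff_hom D d fbar /\ fbar \o i =1 f.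

Section FreeGroup.
Variable S : choiceType.

(* The letter [(s, true)] stands for s and [(s, false)] for s^-1. *)
Definition letter : choiceType := (S * bool)%type.

Definition letter_inv (a : letter) : letter := (a.1, ~~ a.2).

Definition reduced (w : seq letter) : bool :=
  sorted (fun a b => b != letter_inv a) w.

Record free_group : Type :=
  FreeGroup { word :> seq letter; wordP : reduced word }.

HB.instance Definition _ := [isSub for word].
HB.instance Definition _ := [Choice of free_group by <:].

(* The reduced form of the product of a letter and a reduced word. *)
Definition push (a : letter) (w : seq letter) : seq letter :=
  if w is b :: w' then if b == letter_inv a then w' else a :: w else [:: a].

Lemma letter_invK : involutive letter_inv.
Proof. by case=> s b; rewrite /letter_inv /= negbK. Qed.

Lemma reduced_behead a w : reduced (a :: w) -> reduced w.
Proof. exact: path_sorted. Qed.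

Lemma reduced_push a w : reduced w -> reduced (push a w).
Proof.
case: w => [|b w] //= rw; case: ifPn => [_|nab]; first exact: reduced_behead rw.
by rewrite /= nab.
Qed.

Lemma reduced_foldr u w : reduced w -> reduced (foldr push w u).
Proof. by move=> rw; elim: u => //= a u; exact: reduced_push. Qed.

Lemma push_reduced a w : reduced (a :: w) -> push a w = a :: w.
Proof. by case: w => //= b w /andP[/negbTE ->]. Qed.

Lemma pushK a w : reduced w -> push a (push (letter_inv a) w) = w.
Proof.
case: w => [|b w] rw; first by rewrite /= eqxx.
rewrite {2}/push letter_invK; case: eqP => [eba|_]; last by rewrite /= eqxx.
by rewrite -eba push_reduced.
Qed.

Lemma foldr_push a v w :
  reduced w -> foldr push w (push a v) = push a (foldr push w v).
Proof.
case: v => [|b v] //= rw; case: eqP => [->|_] //=.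
by rewrite pushK // reduced_foldr.
Qed.

Lemma foldr_pushA u v w : reduced w ->
  foldr push w (foldr push v u) = foldr push (foldr push w v) u.
Proof. by move=> rw; elim: u => //= a u IHu; rewrite foldr_push // IHu. Qed.

Lemma foldr_push_nil u : reduced u -> foldr push [::] u = u.
Proof.
elim: u => //= a u IHu ru; rewrite IHu ?push_reduced //.
exact: reduced_behead ru.
Qed.

Definition word_inv (w : seq letter) : seq letter := rev (map letter_inv w).

Lemma word_invK : involutive word_inv.
Proof.
by move=> w; rewrite /word_inv map_rev revK -map_comp map_id_in // => a _ /=;
  exact: letter_invK.
Qed.

Lemma reduced_inv w : reduced w -> reduced (word_inv w).
Proof.
rewrite /reduced /word_inv rev_sorted sorted_map.
by apply: sub_sorted => a b nab; rewrite /= letter_invK eq_sym.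
Qed.

Lemma foldr_push_inv w : foldr push w (word_inv w) = [::].
Proof.
elim: w => //= a w IHw.
rewrite /word_inv /= rev_cons foldr_rcons.
have -> : push (letter_inv a) (a :: w) = w by rewrite /push letter_invK eqxx.
exact: IHw.
Qed.

Definition free_one : free_group := @FreeGroup [::] isT.

Definition free_mul (u v : free_group) : free_group :=
  FreeGroup (reduced_foldr u (wordP v)).

Definition free_inv (u : free_group) : free_group :=
  FreeGroup (reduced_inv (wordP u)).

Lemma free_mulA : associative free_mul.
Proof. by move=> u v w; apply: val_inj; rewrite /= foldr_pushA ?wordP. Qed.

Lemma free_mul1g : left_id free_one free_mul.
Proof. by move=> u; apply: val_inj. Qed.

Lemma free_mulg1 : right_id free_one free_mul.
Proof. by move=> u; apply: val_inj; rewrite /= foldr_push_nil ?wordP. Qed.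

Lemma free_mulVg : left_inverse free_one free_inv free_mul.
Proof. by move=> u; apply: val_inj; rewrite /= foldr_push_inv. Qed.

Lemma free_mulgV : right_inverse free_one free_inv free_mul.
Proof.
move=> u; apply: val_inj.
by have := foldr_push_inv (word_inv (word u)); rewrite word_invK.
Qed.

HB.instance Definition _ := isGroup.Build free_group
  free_mulA free_mul1g free_mulg1 free_mulVg free_mulgV.

Definition of_letter (a : letter) : free_group := @FreeGroup [:: a] isT.

Definition free_gen (s : S) : free_group := of_letter (s, true).

End FreeGroup.

(* [{classic X}] is X itself, with the choice structure provided by classical
   logic, so that X can be an arbitrary type. *)
Definition Delta (X : Type) : choiceType := ({classic X} * nat)%type.

Definition free_diff (X : Type) : groupType := free_group (Delta X).

Definition der (X : Type) (x : X) (n : nat) : free_diff X :=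
  free_gen ((x, n) : Delta X).

Definition D_letter (X : Type) (a : letter (Delta X)) : free_diff X :=
  let: ((x, n), b) := a in
  if b then der x n.+1 else (der x n)^-1 * (der x n.+1)^-1 * der x n.

(* Only used on reduced words: the tail of a reduced word is reduced, so the
   recursion stays within reduced words. *)
Fixpoint D_word (X : Type) (w : seq (letter (Delta X))) : free_diff X :=
  match w with
  | [::] => 1
  | [:: a] => D_letter a
  | a :: w' => D_letter a * of_letter a * D_word w' * (of_letter a)^-1
  end.

Definition D (X : Type) (u : free_diff X) : free_diff X := D_word (word u).

Definition iota_X (X : Type) (x : X) : free_diff X := der x 0.

(* Main.v *)
Require Import Defs.
From mathcomp Require Import all_boot.
From mathcomp Require Import boolp.

(** In any group the derivation law d(gh) = d(g) g d(h) g^-1 says exactly that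
    the map g |-> d(g) g is an endomorphism: multiply the law on the right by
    gh ([is_differentialP]).  Differential structures thus become group
    endomorphisms, and everything reduces to the universal property of the free
    group ([lift_monoid_morphism], [free_group_hom_ext]).

    For the first part, the recursion defining D is the one satisfied by
    u |-> E(u) u^-1, where E is the endomorphism of the free group with
    E(x^(n)) = x^(n+1) x^(n).  Hence D(u) u = E(u) for every u
    ([D_mul_self]), so D is differential.

    For the second part, a differential homomorphism extending f must send
    x^(n) = D^n(x^(0)) to d^n(f(x)); this gives uniqueness, and it forces the
    definition of the extension as a group homomorphism phi.  It commutes with
    the derivations because u |-> d(phi u) phi(u) and u |-> phi(D(u) u) are both
    homomorphisms, so that it suffices to compare them on the generators
    ([diff_hom_of_gen]), where they agree by construction. *)

Import Algebra.
Local Open Scope group_scope.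

(** * The universal property of the free group *)

Section FreeGroupTheory.
Variable S : choiceType.
Implicit Types (a : letter S) (s : S) (u v : free_group S).

Lemma of_letter_inv a : of_letter (letter_inv a) = (of_letter a)^-1.
Proof. exact: val_inj. Qed.

(** The products in the inductive step involve no cancellation, so the word of
    [of_letter a * u] is [a :: u]; this is what lets functions defined by
    recursion on reduced words, such as [D], be computed along the induction. *)
Lemma free_group_ind (P : free_group S -> Prop) :
  P 1 ->
  (forall a u, reduced (a :: u) -> P u -> P (of_letter a * u)) ->
  forall u, P u.
Proof.
move=> P1 PM [w rw]; elim: w rw => [|a w IHw] rw.
  by have <- : 1 = FreeGroup rw by exact: val_inj.
have rw' := reduced_behead rw.
suff -> : FreeGroup rw = of_letter a * FreeGroup rw' by apply: PM.
by apply: val_inj; rewrite /= push_reduced.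
Qed.

Section Lift.
Variables (G : groupType) (g : S -> G).

Definition lift_letter a : G := if a.2 then g a.1 else (g a.1)^-1.

Definition lift_word (w : seq (letter S)) : G :=
  foldr (fun a y => lift_letter a * y) 1 w.

Definition lift u : G := lift_word u.

Lemma lift_letter_inv a : lift_letter (letter_inv a) = (lift_letter a)^-1.
Proof. by case: a => s []; rewrite /lift_letter //= invgK. Qed.

Lemma lift_push a w : lift_word (push a w) = lift_letter a * lift_word w.
Proof.
case: w => [|b w] //=; case: eqP => [->|_] //=.
by rewrite lift_letter_inv mulVKg.
Qed.

Lemma lift_monoid_morphism : monoid_morphism lift.
Proof.
split=> // u v; rewrite /lift /=.
elim: (word u) => [|a w IHw] /=; first by rewrite mul1g.
by rewrite lift_push IHw mulgA.
Qed.

Lemma lift_of_letter a : lift (of_letter a) = lift_letter a.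
Proof. exact: mulg1. Qed.

End Lift.

Lemma monoid_morphismV (G H : groupType) (phi : G -> H) (x : G) :
  monoid_morphism phi -> phi x^-1 = (phi x)^-1.
Proof.
by move=> [phi1 phiM]; apply: (mulIg (phi x)); rewrite -phiM !mulVg.
Qed.

Lemma free_group_hom_ext (G : groupType) (phi psi : free_group S -> G) :
  monoid_morphism phi -> monoid_morphism psi ->
  (forall s, phi (free_gen s) = psi (free_gen s)) -> phi =1 psi.
Proof.
move=> phi_hom psi_hom eq_gen.
elim/free_group_ind => [|[s b] u _ IHu]; first by rewrite phi_hom.1 psi_hom.1.
rewrite phi_hom.2 psi_hom.2 IHu; congr (_ * _).
case: b; first exact: eq_gen.
rewrite (_ : of_letter (s, false) = (free_gen s)^-1).
  by rewrite !monoid_morphismV ?eq_gen.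
by rewrite -of_letter_inv.
Qed.

End FreeGroupTheory.

Arguments lift {S G} g u.

(** * Derivations as endomorphisms *)

Lemma is_differentialP (G : groupType) (d : G -> G) :
  is_differential d <-> monoid_morphism (fun g => d g * g).
Proof.
split=> [dM | [_ dgM] g h].
  have mulM g h : d (g * h) * (g * h) = (d g * g) * (d h * h).
    by rewrite dM !mulgA mulgVK.
  split=> //.
  (* A multiplicative map between groups preserves the unit. *)
  by apply: (mulgI (d 1 * 1)); rewrite -mulM !mulg1.
apply: (mulIg (g * h)); rewrite dgM.
by rewrite !mulgA mulgVK.
Qed.

(** Over a free group, compatibility with derivations need only be tested on
    the generators: the maps u |-> d'(phi u) phi(u) and u |-> phi(d(u) u) are
    both homomorphisms. *)
Lemma diff_hom_of_gen (S : choiceType) (G : groupType)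
    (d : free_group S -> free_group S) (d' : G -> G) (phi : free_group S -> G) :
  is_differential d -> is_differential d' -> monoid_morphism phi ->
  (forall s, d' (phi (free_gen s)) = phi (d (free_gen s))) ->
  is_diff_hom d d' phi.
Proof.
move=> /is_differentialP[d1 dM] /is_differentialP[d'1 d'M] phi_hom eq_gen.
split=> // u /=; apply: (mulIg (phi u)); rewrite -phi_hom.2.
pose lhs v := d' (phi v) * phi v; pose rhs v := phi (d v * v).
suff : lhs =1 rhs by apply.
apply: free_group_hom_ext => [||s].
- split=> [|v w]; rewrite /lhs; first by rewrite phi_hom.1 d'1.
  by rewrite phi_hom.2 d'M.
- split=> [|v w]; rewrite /rhs; first by rewrite d1 phi_hom.1.
  by rewrite dM phi_hom.2.
- by rewrite /lhs /rhs phi_hom.2 eq_gen.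
Qed.

(** * The free differential group *)

Section FreeDifferentialGroup.
Variable X : Type.

Definition shift_gen (s : Delta X) : free_diff X := der s.1 s.2.+1 * der s.1 s.2.

Lemma D_letter_mul_self (a : letter (Delta X)) :
  D_letter a * of_letter a = lift_letter _ _ shift_gen a.
Proof.
case: a => [[x n] []] //=.
have -> : of_letter (x, n, false) = (der x n)^-1 by rewrite -of_letter_inv.
by rewrite mulgK /lift_letter /= invgM.
Qed.

(** The separate clause of [D_word] for one-letter words agrees with the
    general one, because [D_word [::] = 1]. *)
Lemma D_word_cons (a : letter (Delta X)) (w : seq (letter (Delta X))) :
  D_word (a :: w) = D_letter a * of_letter a * D_word w * (of_letter a)^-1.
Proof. by case: w => //=; rewrite mulg1 mulgK. Qed.

Lemma D_mul_self (u : free_diff X) : D u * u = lift shift_gen u.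
Proof.
have [lift1 liftM] := lift_monoid_morphism _ _ shift_gen.
elim/free_group_ind: u => [|a u ru IHu]; first by rewrite lift1 mulg1.
rewrite liftM -IHu lift_of_letter -D_letter_mul_self.
have -> : D (of_letter a * u) = D_word (a :: u).
  by rewrite /D /= push_reduced.
by rewrite D_word_cons !mulgA mulgVK.
Qed.

Lemma D_is_differential : is_differential (@D X).
Proof.
apply/is_differentialP.
rewrite (_ : (fun u => D u * u) = lift shift_gen).
  exact: lift_monoid_morphism.
exact/funext/D_mul_self.
Qed.

Lemma diff_hom_der (G : groupType) (d : G -> G) (phi : free_diff X -> G) x n :
  is_diff_hom (@D X) d phi -> phi (der x n) = iter n d (phi (iota_X x)).
Proof.
move=> [_ phiD]; elim: n => //= n <-.
exact/esym/(phiD (der x n)).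
Qed.

Lemma D_is_free : is_free_diff_group (@D X) (@iota_X X).
Proof.
split=> [|G d d_diff f]; first exact: D_is_differential.
pose g (s : Delta X) : G := iter s.2 d (f s.1).
have lift_hom := lift_monoid_morphism _ _ g.
have lift_der x n : lift g (der x n) = iter n d (f x).
  exact: lift_of_letter.
exists (lift g); split=> [|phi [phi_hom phi_iota]].
  split=> [|x]; last exact: lift_der.
  apply: diff_hom_of_gen => // [|[x n]]; first exact: D_is_differential.
  rewrite (lift_der x n); exact/esym/(lift_der x n.+1).
apply/funext/free_group_hom_ext => // [|[x n]]; first exact: phi_hom.1.
by rewrite [LHS]lift_der [RHS](diff_hom_der _ _ _ _ _ phi_hom) -phi_iota.
Qed.

End FreeDifferentialGroup.

Theorem theorem3p4 (X : Type) :
  is_differential (@D X) /\ is_free_diff_group (@D X) (@iota_X X).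
Proof. by split; [exact: D_is_differential | exact: D_is_free]. Qed.
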